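(* Let $k\neq -1$ be a constant. The point transformation $$x'=x^{k+1},\qquad t'=t,\qquad u'=\frac{1}{(k+1)^2}\,x^{-2k}u$$ maps the equation $$u_t=\left(\frac{u_x}{u}\right)_x+\frac{1}{xu}u_x$$ into itself. Applying this transformation $N$ times gives $$x^{(N)}=x^{(k+1)^N},\qquad t^{(N)}=t,\qquad u^{(N)}=\frac{1}{(k+1)^{2N}}\,x^{-2(k+1)^N+2}\,u .$$ This point transformation forms a cyclic group of order $N$ if $k$ is a root of the equation $$(k+1)^N-1=0 .$$ For example, if $N=2$ then (omitting the obvious solution $k=0$) $k=-2$, and the transformation $x'=1/x$, $t'=t$, $u'=x^4u$ forms a cyclic group of order 2. The only real roots of $(k+1)^N-1=0$ are $k=0$ and $k=-2$. If complex roots are introduced, then cyclic groups of any finite order may be constructed; for example, the point transformation $x'=x^{\mathrm i}$, $t'=t$, $u'=-x^{2-2\mathrm i}u$ forms a cyclic group of order 4.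
   Context: Subscripts $x,t$ denote partial derivatives of $u(x,t)$. The equation is the case $n=-1$, $\mu=1$ of the one-dimensional porous medium equation $u_t=(u^nu_x)_x+\frac{\mu}{x}u^nu_x$. A point transformation maps the equation into itself if it transforms the same equation written in the primed variables, for $u'(x',t')$, to the equation in the unprimed variables, for $u(x,t)$. Constants may be complex, and $\mathrm i$ is the imaginary unit.
   Formalization: For a root k of (k+1)^N-1=0 it is proved that the N-th power is the identity and the cyclic group's order divides N; order exactly N is claimed only if k is no root for a smaller positive exponent (k=-2, N=4 gives order 2). *)

(* Defs.v *)
From Stdlib Require Import Reals List FinFun.
From Coquelicot Require Import Coquelicot.

(** * Groups generated by a transformation *)

(* For a transformation of finite order, its natural powers are all its integer
   powers; for one of infinite order they are not closed under inverses. *)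
Definition powers {S : Type} (T : S -> S) : (S -> S) -> Prop :=
  fun g => exists n : nat, g = Nat.iter n T.

Definition is_transformation_group {S : Type} (G : (S -> S) -> Prop) : Prop :=
  G (fun s => s) /\
  (forall g h, G g -> G h -> G (fun s => g (h s))) /\
  (forall g, G g ->
     exists h, G h /\ (forall s, h (g s) = s) /\ (forall s, g (h s) = s)).

Definition has_order {S : Type} (G : (S -> S) -> Prop) (N : nat) : Prop :=
  exists l : list (S -> S),
    NoDup l /\ length l = N /\ forall g, In g l <-> G g.

Definition forms_cyclic_group {S : Type} (T : S -> S) (N : nat) : Prop :=
  is_transformation_group (powers T) /\ has_order (powers T) N.

(** * Real variables, x > 0 *)

Section RealVariables.
Local Open Scope R_scope.

Definition rpoint : Type := (posreal * R * R)%type.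

(* u_t = (u_x / u)_x + u_x / (x u) at (x, t): all the derivatives occurring in
   the equation are required to exist, and u to be nonzero. *)
Definition r_solves_at (u : R -> R -> R) (x t : R) : Prop :=
  u x t <> 0 /\
  exists (ut w : R) (ux : R -> R),
    is_derive (fun s => u x s) t ut /\
    locally x (fun y => is_derive (fun z => u z t) y (ux y)) /\
    is_derive (fun y => ux y / u y t) x w /\
    ut = w + 1 / (x * u x t) * ux x.

(* The hypothesis on u and u' says that T maps the graph of u over D into the
   graph of u'. Since u, u' and the open set D are arbitrary, the equivalence
   says that the equation for u'(x',t') becomes the equation for u(x,t). *)
Definition r_maps_into_itself (T : rpoint -> rpoint) : Prop :=
  Bijective T /\
  forall (D : R * R -> Prop) (u u' : R -> R -> R),
    open D ->
    (forall (x : posreal) (t : R), D (pos x, t) ->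
       let '(x', t', v') := T (x, t, u x t) in u' x' t' = v') ->
    forall (x : posreal) (t : R), D (pos x, t) ->
      let '(x', t', _) := T (x, t, u x t) in
      r_solves_at u' x' t' <-> r_solves_at u x t.

Definition rpow (x : posreal) (a : R) : posreal :=
  mkposreal (Rpower x a) (exp_pos (a * ln x)).

Definition r_transf (k : R) (q : rpoint) : rpoint :=
  let '(x, t, u) := q in
  (rpow x (k + 1), t, 1 / (k + 1) ^ 2 * rpow x (- 2 * k) * u).

End RealVariables.

(** * Complex variables *)

Section ComplexVariables.
Local Open Scope C_scope.

Definition Cexp (z : C) : C :=
  ((exp (Re z) * cos (Im z))%R, (exp (Re z) * sin (Im z))%R).

(* A power x^a with complex exponent is multivalued on C \ {0}, and with a fixed
   branch of the logarithm (x^a)^b = x^(a b) fails. So x ranges over the Riemann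
   surface of the logarithm, a point being given by its logarithm: the point p
   lies above the complex number exp p. Then x |-> x^a is a single-valued map of
   the surface to itself (the origin aside when a = 0), namely p |-> a p. A
   positive real x is the point ln x. *)
Definition logsurf : Type := C.

Definition coord (p : logsurf) : C := Cexp p.

Definition lpow (p : logsurf) (a : C) : logsurf := a * p.

Definition cpow (p : logsurf) (a : C) : C := coord (lpow p a).

Definition cpoint : Type := (logsurf * C * C)%type.

(* Derivative with respect to x = coord p, not with respect to log x = p. *)
Definition is_xderive (f : logsurf -> C) (p : logsurf) (l : C) : Prop :=
  filterlim (fun q : C => (f q - f p) / (coord q - coord p))
            (locally' (p : C)) (locally l).

Definition c_solves_at (u : logsurf -> C -> C) (p : logsurf) (t : C) : Prop :=
  u p t <> 0 /\
  exists (ut w : C) (ux : logsurf -> C),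
    is_derive (fun s : C => u p s) t ut /\
    locally (p : C) (fun q : C => is_xderive (fun r => u r t) q (ux q)) /\
    is_xderive (fun q => ux q / u q t) p w /\
    ut = w + 1 / (coord p * u p t) * ux p.

Definition c_maps_into_itself (T : cpoint -> cpoint) : Prop :=
  Bijective T /\
  forall (D : C * C -> Prop) (u u' : logsurf -> C -> C),
    open D ->
    (forall (p : logsurf) (t : C), D (p, t) ->
       let '(p', t', v') := T (p, t, u p t) in u' p' t' = v') ->
    forall (p : logsurf) (t : C), D (p, t) ->
      let '(p', t', _) := T (p, t, u p t) in
      c_solves_at u' p' t' <-> c_solves_at u p t.

Definition c_transf (k : C) (q : cpoint) : cpoint :=
  let '(p, t, u) := q in
  (lpow p (k + 1), t, 1 / (k + 1) ^ 2 * cpow p (- (2) * k) * u).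

End ComplexVariables.

(* Main.v *)
Require Import Defs.
From Stdlib Require Import Reals Arith Lra Lia List FinFun Field Classical.
From Stdlib Require Import FunctionalExtensionality ProofIrrelevance.
From Coquelicot Require Import Coquelicot.

(** Write [m = k + 1] and [S_m] for the transformation
    [(x, t, u) |-> (x^m, t, m^(-2) x^(2 - 2 m) u)].

    Everything about groups follows from the law [S_a o S_b = S_(a b)]
    ([r_transf_comp], [c_transf_comp]) and from [S_1 = id]: the inverse of [S_m]
    is [S_(1/m)], its iterates are [S_(m^N)], and [S_m^N = id] exactly when
    [m^N = 1], since the first coordinate of [S_a] determines [a]. A map with
    [T^N = id] whose smaller positive powers differ from the identity generates
    a cyclic group of order [N] ([forms_cyclic_group_intro]); the least positive
    exponent [d] with [T^d = id] always divides [N]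
    ([forms_cyclic_group_dividing]). Every order occurs for complex [k], because
    [exp (2 pi i / N)] is a primitive [N]-th root of unity.

    The invariance of the equation becomes transparent in the variable
    [p = log x]. There the right-hand side loses its first-order term and the
    equation reads [x^2 u_t = (u_p / u)_p]. The transformation is [p' = m p], and
    multiplying [u] by [c x^(2 - 2 m)] adds the constant [2 - 2 m] to [u_p / u].
    So both sides are multiplied by [m^(-2)]: the right one because of the two
    derivatives with respect to [p'] ([log_solves_scale]), the left one because
    [x'^2 u' = m^(-2) x^2 u]. The converse is the same statement for [1 / m]
    ([x_solves_scale_iff]).

    This argument is carried out once, over an arbitrary valued field with an
    exponential function. It applies to the real equation by composing with [exp]
    ([r_solves_at_x_solves]). In the complex case the logarithm is already the
    coordinate of the Riemann surface, and the remaining point is that the limit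
    of the quotients [(f q - f p) / (exp q - exp p)] is the derivative in [p]
    divided by [exp p] ([is_xderive_iff]). *)

(** * Cyclic groups generated by a map of finite order *)

Lemma iter_multiple {S : Type} (T : S -> S) (N q : nat) :
  (forall s, Nat.iter N T s = s) -> forall s, Nat.iter (q * N) T s = s.
Proof.
  intros HN s. induction q as [|q IH]; [reflexivity|].
  simpl Nat.mul. now rewrite Nat.iter_add, IH, HN.
Qed.

Lemma iter_mod {S : Type} (T : S -> S) (N n : nat) :
  (forall s, Nat.iter N T s = s) ->
  forall s, Nat.iter (n mod N) T s = Nat.iter n T s.
Proof.
  intros HN s. transitivity (Nat.iter (n mod N + n / N * N) T s).
  - now rewrite Nat.iter_add, iter_multiple.
  - f_equal. pose proof (Nat.div_mod_eq n N). lia.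
Qed.

Lemma iter_injective {S : Type} (T : S -> S) (N i j : nat) :
  (forall s, Nat.iter N T s = s) ->
  (forall m, (1 <= m < N)%nat -> exists s, Nat.iter m T s <> s) ->
  (i < j < N)%nat -> Nat.iter i T <> Nat.iter j T.
Proof.
  intros HN Hmin Hij Heq.
  destruct (Hmin (N - j + i)%nat) as [s Hs]; [lia|]. apply Hs.
  rewrite Nat.iter_add, Heq, <- Nat.iter_add.
  replace (N - j + j)%nat with N by lia. apply HN.
Qed.

(** The distinct powers are those with exponent below [N], and the inverse of
    [T^a] is [T^(N - a mod N)]. *)
Lemma forms_cyclic_group_intro {S : Type} (T : S -> S) (N : nat) :
  (1 <= N)%nat ->
  (forall s, Nat.iter N T s = s) ->
  (forall m, (1 <= m < N)%nat -> exists s, Nat.iter m T s <> s) ->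
  forms_cyclic_group T N.
Proof.
  intros HN1 HN Hmin. split; [split; [|split]|].
  - now exists 0%nat.
  - intros g h [a ->] [b ->]. exists (a + b)%nat.
    apply functional_extensionality. intros s. symmetry. apply Nat.iter_add.
  - intros g [a ->]. pose proof (Nat.mod_upper_bound a N ltac:(lia)) as Hlt.
    exists (Nat.iter (N - a mod N) T). split; [now exists (N - a mod N)%nat|].
    split; intros s.
    + rewrite <- (iter_mod T N a HN), <- Nat.iter_add.
      replace (N - a mod N + a mod N)%nat with N by lia. apply HN.
    + rewrite <- (iter_mod T N a HN), <- Nat.iter_add.
      replace (a mod N + (N - a mod N))%nat with N by lia. apply HN.
  - exists (map (fun m => Nat.iter m T) (seq 0 N)). split; [|split].
    + apply Injective_map_NoDup_in; [|apply seq_NoDup].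
      intros i j Hi Hj Heq. apply in_seq in Hi, Hj.
      destruct (Nat.lt_trichotomy i j) as [H|[H|H]]; [exfalso|exact H|exfalso].
      * now apply (iter_injective T N i j HN Hmin); [lia|].
      * now apply (iter_injective T N j i HN Hmin); [lia|].
    + now rewrite length_map, length_seq.
    + intros g. rewrite in_map_iff. split.
      * intros [m [<- _]]. now exists m.
      * intros [m ->]. exists (m mod N). split.
        -- apply functional_extensionality, (iter_mod T N m HN).
        -- apply in_seq. pose proof (Nat.mod_upper_bound m N). lia.
Qed.

(** The order is the least positive [d] with [T^d = id]; it divides [N] because
    [T^(N mod d) = id] too. *)
Lemma forms_cyclic_group_dividing {S : Type} (T : S -> S) (N : nat) :
  (1 <= N)%nat -> (forall s, Nat.iter N T s = s) ->
  exists d, Nat.divide d N /\ forms_cyclic_group T d.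
Proof.
  intros HN1 HN.
  assert (Hleast : exists d, ((1 <= d)%nat /\ forall s, Nat.iter d T s = s) /\
            forall m, (1 <= m < d)%nat -> exists s, Nat.iter m T s <> s).
  { revert HN1 HN. induction N as [N IH] using lt_wf_ind. intros HN1 HN.
    destruct (classic (exists m, (1 <= m < N)%nat
                                 /\ forall s, Nat.iter m T s = s))
      as [[m [Hm HmT]]|Hno].
    - apply (IH m); [lia|lia|exact HmT].
    - exists N. split; [now split|]. intros m Hm.
      apply not_all_ex_not. intros Hall. apply Hno. now exists m. }
  destruct Hleast as [d [[Hd HdT] Hmin]]. exists d.
  split; [|now apply forms_cyclic_group_intro].
  apply Nat.Lcm0.mod_divide.
  destruct (Nat.eq_dec (N mod d) 0) as [H|H]; [exact H|exfalso].
  destruct (Hmin (N mod d)) as [s Hs].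
  { pose proof (Nat.mod_upper_bound N d). lia. }
  apply Hs. now rewrite iter_mod, HN.
Qed.

(** * The equation in the logarithmic variable *)

(** The operations of the underlying structure, all stated on the one carrier
    type [K]. Written directly, they go through different projections of the
    hierarchy, which [ring] and [field] do not recognize as equal. *)
Definition kzero {K : AbsRing} : K := zero.
Definition kone {K : AbsRing} : K := one.
Definition kadd {K : AbsRing} (x y : K) : K := plus x y.
Definition kmul {K : AbsRing} (x y : K) : K := mult x y.
Definition ksub {K : AbsRing} (x y : K) : K := minus x y.
Definition kopp {K : AbsRing} (x : K) : K := opp x.

Declare Scope absfield_scope.
Notation "0" := kzero : absfield_scope.
Notation "1" := kone : absfield_scope.
Infix "+" := kadd : absfield_scope.
Infix "*" := kmul : absfield_scope.
Infix "-" := ksub : absfield_scope.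

Section LogEquation.
Local Open Scope absfield_scope.

Variables (K : AbsRing) (div : K -> K -> K) (inv E : K -> K).
Hypothesis K_field :
  @field_theory K 0 1 kadd kmul ksub kopp div inv eq.
Hypothesis E_derive : forall p, is_derive E p (E p).
Hypothesis E_plus : forall p q, E (p + q) = E p * E q.
Hypothesis E_zero : E 0 = 1.

Add Field K_field : K_field.

Local Infix "/" := div : absfield_scope.

(** The equation in [x] along the parametrization [x = E p], where [l] is the
    derivative of [f] with respect to [x] at [E p] when [l * E p] is its
    derivative with respect to [p]. *)
Definition x_solves (u : K -> K -> K) (p t : K) : Prop :=
  u p t <> 0 /\
  exists (ut w : K) (ux : K -> K),
    is_derive (fun s => u p s) t ut /\
    locally p (fun q => is_derive (fun r => u r t) q (ux q * E q)) /\
    is_derive (fun q => ux q / u q t) p (w * E p) /\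
    ut = w + 1 / (E p * u p t) * ux p.

(** The equation [x^2 u_t = (u_p / u)_p]. The logarithmic derivative [l] of [u]
    is given by [u_p = l u], so that its transformation needs no division. *)
Definition log_solves (u : K -> K -> K) (p t : K) : Prop :=
  u p t <> 0 /\
  exists (ut w : K) (l : K -> K),
    is_derive (fun s => u p s) t ut /\
    locally p (fun q => is_derive (fun r => u r t) q (l q * u q t)) /\
    is_derive l p w /\
    E p * E p * ut = w.

Lemma is_derive_eq (f : K -> K) (p a b : K) :
  is_derive f p a -> a = b -> is_derive f p b.
Proof. now intros H <-. Qed.

Lemma is_derive_kmul (f g : K -> K) (p a b : K) :
  is_derive f p a -> is_derive g p b ->
  is_derive (fun q => f q * g q) p (a * g p + f p * b).
Proof.
  intros Hf Hg. apply (is_derive_mult f g p a b Hf Hg).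
  intros x y. change (x * y = y * x). ring.
Qed.

Lemma is_derive_kcomp (f g : K -> K) (p a b : K) :
  is_derive f (g p) a -> is_derive g p b ->
  is_derive (fun q => f (g q)) p (b * a).
Proof. exact (is_derive_comp f g p a b). Qed.

Lemma is_derive_scale (f : K -> K) (m p a : K) :
  is_derive f p a -> is_derive (fun q => m * f q) p (m * a).
Proof.
  intros Hf. eapply is_derive_eq.
  - apply is_derive_kmul; [apply is_derive_const | exact Hf].
  - change (0 * f p + m * a = m * a). ring.
Qed.

Lemma is_derive_kid (p : K) : is_derive (fun q : K => q) p 1.
Proof. exact (is_derive_id p). Qed.

Lemma E_neq0 (p : K) : E p <> 0.
Proof.
  intros H. apply (F_1_neq_0 K_field). rewrite <- E_zero.
  replace (0 : K) with (p + kopp p) by ring.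
  rewrite E_plus, H. ring.
Qed.

Lemma kmul_eq0 (x y : K) : x * y = 0 -> x <> 0 -> y = 0.
Proof.
  intros H Hx. transitivity (x * y / x); [now field|].
  rewrite H. now field.
Qed.

Lemma kmul_neq0 (x y : K) : x <> 0 -> y <> 0 -> x * y <> 0.
Proof. intros Hx Hy H. exact (Hy (kmul_eq0 x y H Hx)). Qed.

Lemma is_derive_cont (f : K -> K) (p l : K) : is_derive f p l -> continuous f p.
Proof. intros Hf. apply (ex_derive_continuous f). now exists l. Qed.

Lemma locally_neq0 (f : K -> K) (p l : K) :
  is_derive f p l -> f p <> 0 -> locally p (fun q => f q <> 0).
Proof.
  intros Hf Hp.
  apply (is_derive_cont f p l Hf (fun y => y <> 0)).
  assert (Hpos : 0%R < norm (f p)).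
  { destruct (Rle_lt_or_eq_dec _ _ (norm_ge_0 (f p))) as [H|H]; [exact H|].
    exfalso. apply Hp. symmetry in H.
    exact (norm_eq_zero (V := AbsRing_NormedModule K) (f p) H). }
  apply (locally_le_locally_norm (V := AbsRing_NormedModule K) (f p)
           (fun y => y <> 0)).
  exists (mkposreal _ Hpos). intros y Hy Hy0.
  rewrite Hy0 in Hy. apply (Rlt_irrefl (norm (f p))).
  rewrite <- (norm_opp (V := AbsRing_NormedModule K) (f p)) at 1.
  refine (eq_ind _ (fun z : K => (norm z < norm (f p))%R) Hy _ _).
  apply (plus_zero_l (G := AbsRing.AbelianGroup K)).
Qed.

Lemma locally_scale (m n p : K) (P : K -> Prop) :
  n * m = 1 -> locally p P -> locally (m * p) (fun r => P (n * r)).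
Proof.
  intros Hmn HP.
  assert (Hc : continuous (fun r => n * r) (m * p))
    by (eapply is_derive_cont, is_derive_scale, is_derive_kid).
  apply Hc. replace (n * (m * p)) with p; [exact HP|].
  transitivity (n * m * p); [rewrite Hmn|]; ring.
Qed.

(** With [l = u_p / u] one has [u_x / u = l / x] and [d/dx = x^(-1) d/dp], so
    [(u_x / u)_x = (l_p - l) / x^2]. The term [u_x / (x u) = l / x^2] cancels the
    [- l], which leaves [u_t = l_p / x^2]. *)
Lemma x_solves_log (u : K -> K -> K) (p t : K) :
  x_solves u p t <-> log_solves u p t.
Proof.
  split; intros [Hu [ut [w [f [Ht [Hx [Hw Heq]]]]]]]; split; try exact Hu;
    pose proof (locally_neq0 _ _ _ (locally_singleton _ _ Hx) Hu) as Hnz;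
    pose proof (E_neq0 p) as HE.
  - exists ut, (E p * E p * ut), (fun q => E q * (f q / u q t)).
    split; [|split; [|split]].
    + exact Ht.
    + generalize (filter_and _ _ Hx Hnz). apply filter_imp.
      intros q [Hq Hq0]. eapply is_derive_eq; [exact Hq | now field].
    + eapply is_derive_eq;
        [apply is_derive_kmul; [apply E_derive | exact Hw]|].
      rewrite Heq. field. now split.
    + reflexivity.
  - exists ut, (ut - f p / (E p * E p)), (fun q => f q * u q t / E q).
    split; [|split; [|split]].
    + exact Ht.
    + generalize Hx. apply filter_imp. intros q Hq. pose proof (E_neq0 q).
      eapply is_derive_eq; [exact Hq | now field].
    (* [f q / E q] is differentiated as the product [f q * E (- q)]. *)
    + apply (is_derive_ext_loc (fun q => f q * E (kopp q))).
      { generalize Hnz. apply filter_imp. intros q Hq.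
        assert (H1 : E q * E (kopp q) = 1).
        { rewrite <- E_plus, <- E_zero. f_equal. ring. }
        pose proof (E_neq0 q).
        replace (E (kopp q)) with (1 / E q) by (rewrite <- H1; now field).
        change (f q * (1 / E q) = f q * u q t / E q / u q t).
        field. now split. }
      eapply is_derive_eq.
      { apply is_derive_kmul; [exact Hw|].
        apply (is_derive_kcomp E kopp); [apply E_derive|].
        apply (is_derive_opp (fun q : K => q)), is_derive_kid. }
      assert (H1 : E p * E (kopp p) = 1).
      { rewrite <- E_plus, <- E_zero. f_equal. ring. }
      change (w * E (kopp p) + f p * (kopp 1 * E (kopp p))
              = (ut - f p / (E p * E p)) * E p).
      replace (E (kopp p)) with (1 / E p) by (rewrite <- H1; now field).
      rewrite <- Heq. now field.
    + field. now split.
Qed.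

(** If [v (m p) = g p * u p] with [g' = a g], then the logarithmic derivative of
    [v] at [m p] is [(a + l p) / m], where [l] is that of [u]. The constant [a]
    disappears in the second derivative. *)
Lemma log_solves_scale (u v : K -> K -> K) (g : K -> K) (a m n p t : K) :
  n * m = 1 ->
  (forall q, is_derive g q (a * g q)) -> (forall q, g q <> 0) ->
  E (m * p) * E (m * p) * g p = n * n * (E p * E p) ->
  locally p (fun q => v (m * q) t = g q * u q t) ->
  locally t (fun s => v (m * p) s = g p * u p s) ->
  log_solves u p t -> log_solves v (m * p) t.
Proof.
  intros Hnm Hg Hg0 Hgp Hq Hs [Hu [ut [w [l [Ht [Hx [Hw Heq]]]]]]].
  assert (Hmul : forall q, m * (n * q) = q).
  { intros q. transitivity (n * m * q); [|rewrite Hnm]; ring. }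
  assert (Hnp : n * (m * p) = p).
  { transitivity (n * m * p); [|rewrite Hnm]; ring. }
  split.
  { rewrite (locally_singleton _ _ Hq). now apply kmul_neq0. }
  exists (g p * ut), (n * (n * w)), (fun r => n * (a + l (n * r))).
  assert (Hv : locally (m * p) (fun r => v r t = g (n * r) * u (n * r) t)).
  { generalize (locally_scale m n p _ Hnm Hq). apply filter_imp.
    intros r Hr. now rewrite Hmul in Hr. }
  split; [|split; [|split]].
  - apply (is_derive_ext_loc (fun s => g p * u p s)).
    + generalize Hs. now apply filter_imp.
    + now apply is_derive_scale.
  - generalize (filter_and _ _ (locally_scale m n p _ Hnm Hx)
                  (locally_locally _ _ Hv)).
    apply filter_imp. intros r [Hr Hrv].
    apply (is_derive_ext_loc (fun r => g (n * r) * u (n * r) t)).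
    { generalize Hrv. now apply filter_imp. }
    rewrite (locally_singleton _ _ Hrv).
    eapply is_derive_eq.
    { apply is_derive_kmul.
      - apply (is_derive_kcomp g (fun r => n * r)); [apply Hg|].
        apply is_derive_scale, is_derive_kid.
      - apply (is_derive_kcomp (fun r => u r t) (fun r => n * r)); [exact Hr|].
        apply is_derive_scale, is_derive_kid. }
    cbv beta. ring.
  - apply is_derive_scale. eapply is_derive_eq.
    { apply (is_derive_plus (fun _ => a) (fun r => l (n * r)));
        [apply is_derive_const|].
      apply (is_derive_kcomp l (fun r => n * r)).
      - rewrite Hnp. exact Hw.
      - apply is_derive_scale, is_derive_kid. }
    change (0 + n * 1 * w = n * w). ring.
  - rewrite <- Heq.
    transitivity (E (m * p) * E (m * p) * g p * ut); [|rewrite Hgp]; ring.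
Qed.

(** The relation between [u] and [v] can be solved for [u], and then has the same
    form with [m] and [n = 1 / m] exchanged. Hence [log_solves_scale] gives both
    directions. *)
Lemma x_solves_scale_iff (u v : K -> K -> K) (m n p t : K) :
  n * m = 1 ->
  locally p (fun q => v (m * q) t = n * n * E ((1 + 1 - (1 + 1) * m) * q) * u q t) ->
  locally t (fun s => v (m * p) s = n * n * E ((1 + 1 - (1 + 1) * m) * p) * u p s) ->
  x_solves v (m * p) t <-> x_solves u p t.
Proof.
  intros Hnm Hq Hs. rewrite !x_solves_log.
  assert (Hder : forall c a q,
    is_derive (fun q => c * E (a * q)) q (a * (c * E (a * q)))).
  { intros c a q. eapply is_derive_eq.
    - apply is_derive_scale, (is_derive_kcomp E (fun q => a * q));
        [apply E_derive | apply is_derive_scale, is_derive_kid].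
    - ring. }
  assert (Hn : n <> 0).
  { intros H. apply (F_1_neq_0 K_field). rewrite <- Hnm, H. ring. }
  assert (Hm : m <> 0).
  { intros H. apply (F_1_neq_0 K_field). rewrite <- Hnm, H. ring. }
  assert (Hgn : forall c a q, c <> 0 -> c * E (a * q) <> 0).
  { intros c a q Hc. apply kmul_neq0; [exact Hc | apply E_neq0]. }
  assert (Hmul : forall q, m * (n * q) = q).
  { intros q. transitivity (n * m * q); [|rewrite Hnm]; ring. }
  assert (Hnp : forall q, n * (m * q) = q).
  { intros q. transitivity (n * m * q); [|rewrite Hnm]; ring. }
  assert (Hinv : forall q y z, z = n * n * E ((1 + 1 - (1 + 1) * m) * q) * y ->
    y = m * m * E ((1 + 1 - (1 + 1) * n) * (m * q)) * z).
  { intros q y z ->.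
    transitivity (n * m * (n * m) * (E ((1 + 1 - (1 + 1) * n) * (m * q))
                  * E ((1 + 1 - (1 + 1) * m) * q)) * y); [|ring].
    rewrite <- E_plus.
    replace ((1 + 1 - (1 + 1) * n) * (m * q) + (1 + 1 - (1 + 1) * m) * q)
      with ((1 + 1) * q - (1 + 1) * (n * m) * q) by ring.
    rewrite Hnm. replace ((1 + 1) * q - (1 + 1) * 1 * q) with (@kzero K) by ring.
    rewrite E_zero. ring. }
  split; intros H.
  - rewrite <- (Hnp p).
    apply (log_solves_scale v u
             (fun q => m * m * E ((1 + 1 - (1 + 1) * n) * q))
             (1 + 1 - (1 + 1) * n) n m (m * p) t); try exact H.
    + rewrite <- Hnm. ring.
    + apply Hder.
    + intros q. now apply Hgn, kmul_neq0.
    + rewrite Hnp.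
      replace (E p * E p * (m * m * E ((1 + 1 - (1 + 1) * n) * (m * p))))
        with (m * m * (E (p + p) * E ((1 + 1 - (1 + 1) * n) * (m * p))))
        by (rewrite E_plus; ring).
      rewrite <- !E_plus. do 2 f_equal.
      transitivity (p + p + (1 + 1) * (m * p) - (1 + 1) * (n * (m * p))); [ring|].
      rewrite Hnp. ring.
    + generalize (locally_scale m n p _ Hnm Hq). apply filter_imp. intros r Hr.
      rewrite Hmul in Hr. rewrite (Hinv _ _ _ Hr), Hmul. reflexivity.
    + rewrite Hnp. generalize Hs. apply filter_imp. intros s Hr. now apply Hinv.
  - apply (log_solves_scale u v
             (fun q => n * n * E ((1 + 1 - (1 + 1) * m) * q))
             (1 + 1 - (1 + 1) * m) m n p t); try assumption.
    + apply Hder.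
    + intros q. now apply Hgn, kmul_neq0.
    + replace (E (m * p) * E (m * p) * (n * n * E ((1 + 1 - (1 + 1) * m) * p)))
        with (n * n * (E (m * p + m * p) * E ((1 + 1 - (1 + 1) * m) * p)))
        by (rewrite E_plus; ring).
      rewrite <- !E_plus. do 2 f_equal. ring.
Qed.

End LogEquation.

Lemma locally_slice_fst {U V : UniformSpace} (D : U * V -> Prop) (x : U) (t : V) :
  open D -> D (x, t) -> locally x (fun y => D (y, t)).
Proof.
  intros HD H. destruct (HD _ H) as [eps He]. exists eps. intros y Hy.
  apply He. split; [exact Hy | apply ball_center].
Qed.

Lemma locally_slice_snd {U V : UniformSpace} (D : U * V -> Prop) (x : U) (t : V) :
  open D -> D (x, t) -> locally t (fun s => D (x, s)).
Proof.
  intros HD H. destruct (HD _ H) as [eps He]. exists eps. intros y Hy.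
  apply He. split; [apply ball_center | exact Hy].
Qed.

(** * The real equation *)

Section RealVariables.
Local Open Scope R_scope.

Lemma posreal_eq (x y : posreal) : pos x = pos y -> x = y.
Proof.
  destruct x as [x Hx], y as [y Hy]. simpl. intros <-.
  f_equal. apply proof_irrelevance.
Qed.

(** The exponents agree because [x^(- 2 b)] times [(x^(b + 1))^(- 2 a)] is
    [x^(- 2 ((a + 1) (b + 1) - 1))]. *)
Lemma r_transf_comp (a b : R) (q : rpoint) :
  a <> -1 -> b <> -1 ->
  r_transf a (r_transf b q) = r_transf ((a + 1) * (b + 1) - 1) q.
Proof.
  intros Ha Hb. destruct q as [[x t] v]. unfold r_transf.
  f_equal; [f_equal|].
  - apply posreal_eq. simpl. rewrite Rpower_mult. f_equal. ring.
  - simpl pos. rewrite Rpower_mult.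
    replace (-2 * ((a + 1) * (b + 1) - 1))
      with ((b + 1) * (-2 * a) + -2 * b) by ring.
    rewrite Rpower_plus. field. repeat split; try lra.
    replace ((a + 1) * (b + 1) - 1 + 1) with ((a + 1) * (b + 1)) by ring.
    apply Rmult_integral_contrapositive; lra.
Qed.

Lemma r_transf_id (q : rpoint) : r_transf 0 q = q.
Proof.
  destruct q as [[x t] v]. unfold r_transf. f_equal; [f_equal|].
  - apply posreal_eq. simpl. rewrite Rplus_0_l. apply Rpower_1, cond_pos.
  - simpl pos. rewrite Rmult_0_r, Rpower_O by apply cond_pos. field.
Qed.

Lemma r_transf_iter (k : R) (N : nat) (q : rpoint) :
  k <> -1 -> Nat.iter N (r_transf k) q = r_transf ((k + 1) ^ N - 1) q.
Proof.
  intros Hk. induction N as [|N IH].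
  - simpl. rewrite Rminus_diag. symmetry. apply r_transf_id.
  - simpl Nat.iter. rewrite IH, r_transf_comp; [|exact Hk|].
    + f_equal. simpl. ring.
    + intros H. apply (pow_nonzero (k + 1) N); lra.
Qed.

Lemma is_derive_exp_iff (f : R -> R) (p l : R) :
  is_derive f (exp p) l <-> is_derive (fun q => f (exp q)) p (l * exp p).
Proof.
  split; intros H.
  - replace (l * exp p) with (scal (exp p) l) by apply Rmult_comm.
    apply (is_derive_comp f exp); [exact H | apply is_derive_exp].
  - apply (is_derive_ext_loc (fun y => f (exp (ln y)))).
    + exists (mkposreal _ (exp_pos p)). intros y Hy.
      f_equal. apply exp_ln.
      unfold ball in Hy; simpl in Hy; unfold AbsRing_ball, abs in Hy; simpl in Hy.
      unfold minus, plus, opp in Hy; simpl in Hy.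
      apply Rabs_def2 in Hy. lra.
    + replace l with (scal (/ exp p) (l * exp p)).
      2:{ unfold scal; simpl; unfold mult; simpl. field.
          apply Rgt_not_eq, exp_pos. }
      apply (is_derive_comp (fun q => f (exp q)) ln).
      * now rewrite ln_exp.
      * apply is_derive_ln, exp_pos.
Qed.

Lemma continuous_ln (y : R) : 0 < y -> continuous ln y.
Proof. intros Hy. apply (ex_derive_continuous ln). exists (/ y). now apply is_derive_ln. Qed.

Lemma continuous_exp (p : R) : continuous exp p.
Proof. apply (ex_derive_continuous exp). exists (exp p). apply is_derive_exp. Qed.

Lemma r_solves_at_x_solves (u : R -> R -> R) (p t : R) :
  r_solves_at u (exp p) t <-> x_solves R_AbsRing Rdiv exp (fun q s => u (exp q) s) p t.
Proof.
  split; intros [Hu [ut [w [ux [Ht [Hx [Hw Heq]]]]]]]; split; try exact Hu.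
  - exists ut, w, (fun q => ux (exp q)). split; [exact Ht|]. split; [|split].
    + eapply filter_imp; [|exact (continuous_exp p _ Hx)]. intros q Hq.
      exact (proj1 (is_derive_exp_iff (fun y => u y t) q _) Hq).
    + exact (proj1 (is_derive_exp_iff (fun y => ux y / u y t) p _) Hw).
    + exact Heq.
  - exists ut, w, (fun y => ux (ln y)). split; [exact Ht|]. split; [|split].
    + rewrite <- (ln_exp p) in Hx.
      assert (Hln : locally (exp p) (fun y =>
                is_derive (fun r => u (exp r) t) (ln y) (ux (ln y) * exp (ln y))))
        by exact (continuous_ln _ (exp_pos p) _ Hx).
      generalize (filter_and _ _ Hln (open_gt 0 _ (exp_pos p))).
      apply filter_imp. intros y [Hy Hy0].
      rewrite <- (exp_ln y Hy0) at 1. apply is_derive_exp_iff. exact Hy.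
    + apply is_derive_exp_iff. apply (is_derive_ext (fun q => ux q / u (exp q) t)).
      * intros q. now rewrite ln_exp.
      * exact Hw.
    + rewrite ln_exp. exact Heq.
Qed.

Lemma r_transf_maps (k : R) : k <> -1 -> r_maps_into_itself (r_transf k).
Proof.
  intros Hk. split.
  - exists (r_transf (/ (k + 1) - 1)).
    assert (Hk1 : / (k + 1) - 1 <> -1).
    { intros H. assert (k + 1 <> 0) by lra.
      apply (Rinv_neq_0_compat (k + 1)); lra. }
    split; intros q; rewrite r_transf_comp by assumption;
      rewrite <- (r_transf_id q) at 2; f_equal; field; lra.
  - intros D u v HD Hrel x t HDxt. unfold r_transf.
    unfold r_transf in Hrel. simpl in Hrel |- *.
    assert (Hrel' : forall q s, D (exp q, s) ->
      v (exp ((k + 1) * q)) s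
      = (/ (k + 1)) * (/ (k + 1)) * exp ((1 + 1 - (1 + 1) * (k + 1)) * q)
        * u (exp q) s).
    { intros q s Hq. pose proof (Hrel (mkposreal _ (exp_pos q)) s Hq) as H.
      simpl in H. unfold Rpower in H. rewrite ln_exp in H. rewrite H.
      replace ((1 + 1 - (1 + 1) * (k + 1)) * q) with (-2 * k * q) by ring.
      field. lra. }
    clear Hrel. unfold Rpower.
    pose proof (eq_sym (exp_ln x (cond_pos x))) as Hp.
    set (p := ln x) in Hp |- *. clearbody p. rewrite Hp in HDxt |- *.
    rewrite !r_solves_at_x_solves.
    apply (x_solves_scale_iff R_AbsRing Rdiv Rinv exp Rfield is_derive_exp exp_plus exp_0
      (fun q s => u (exp q) s) (fun q s => v (exp q) s) (k + 1) (/ (k + 1))).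
    + apply Rinv_l. lra.
    + eapply filter_imp;
        [|exact (continuous_exp p _ (locally_slice_fst D _ _ HD HDxt))].
      intros q Hq. exact (Hrel' q t Hq).
    + eapply filter_imp; [|exact (locally_slice_snd D _ _ HD HDxt)].
      intros s Hs. exact (Hrel' p s Hs).
Qed.

(** The [m]-th power takes [x = exp 1] to [exp ((k + 1)^m)]. *)
Lemma r_transf_order (k : R) (m : nat) :
  k <> -1 -> (forall q, Nat.iter m (r_transf k) q = q) <-> ((k + 1) ^ m - 1 = 0).
Proof.
  intros Hk. split.
  - intros H. specialize (H (mkposreal _ (exp_pos 1), 0, 0)).
    rewrite r_transf_iter in H by exact Hk.
    injection H as H _. unfold Rpower in H. rewrite ln_exp in H.
    apply exp_inv in H. lra.
  - intros H q. rewrite r_transf_iter, H by exact Hk. apply r_transf_id.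
Qed.

Lemma r_transf_cyclic (k : R) (N : nat) :
  k <> -1 -> (1 <= N)%nat -> (k + 1) ^ N - 1 = 0 ->
  (forall m, (1 <= m < N)%nat -> (k + 1) ^ m - 1 <> 0) ->
  forms_cyclic_group (r_transf k) N.
Proof.
  intros Hk HN HkN Hm. apply forms_cyclic_group_intro; [exact HN| |].
  - now apply r_transf_order.
  - intros m Hmr. apply not_all_ex_not. intros H. apply (Hm m Hmr).
    now apply r_transf_order.
Qed.

Lemma real_root_of_unity (k : R) :
  (exists N : nat, (1 <= N)%nat /\ (k + 1) ^ N - 1 = 0) <-> k = 0 \/ k = -2.
Proof.
  split.
  - intros [N [HN H]].
    destruct (pow_R1 (k + 1) N) as [H1|H1]; [lra| |lia].
    revert H1. unfold Rabs. destruct (Rcase_abs (k + 1)); lra.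
  - intros [-> | ->].
    + exists 1%nat. split; [lia | simpl; ring].
    + exists 2%nat. split; [lia | simpl; ring].
Qed.

Lemma r_transf_iter_formula (k : R) (N : nat) (x : posreal) (t u : R) :
  k <> -1 ->
  Nat.iter N (r_transf k) (x, t, u)
  = (rpow x ((k + 1) ^ N), t,
     1 / (k + 1) ^ (2 * N) * rpow x (- 2 * (k + 1) ^ N + 2) * u).
Proof.
  intros Hk. rewrite r_transf_iter by exact Hk. unfold r_transf.
  replace ((k + 1) ^ N - 1 + 1) with ((k + 1) ^ N) by ring.
  replace (-2 * ((k + 1) ^ N - 1)) with (-2 * (k + 1) ^ N + 2) by ring.
  now rewrite <- pow_mult, Nat.mul_comm.
Qed.

Lemma r_transf_inversion (x : posreal) (t u : R) :
  let '(x', t', u') := r_transf (-2) (x, t, u) in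
  pos x' = 1 / x /\ t' = t /\ u' = x ^ 4 * u.
Proof.
  unfold r_transf. cbn [pos rpow]. split; [|split; [reflexivity|]].
  - replace (-2 + 1) with (- (1)) by ring.
    rewrite Rpower_Ropp, Rpower_1 by apply cond_pos. field.
    apply Rgt_not_eq, cond_pos.
  - replace (-2 * -2) with (INR 4) by (simpl; ring).
    rewrite Rpower_pow by apply cond_pos. field.
Qed.

Lemma r_inversion_cyclic : forms_cyclic_group (r_transf (-2)) 2.
Proof.
  apply r_transf_cyclic; [lra|lia|simpl; ring|].
  intros m Hm. replace m with 1%nat by lia. simpl. lra.
Qed.

End RealVariables.

(** * The complex equation *)

Section ComplexVariables.
Local Open Scope C_scope.

(** The common form to which the several notions of derivative of a complex
    function are reduced. *)
Definition C_derive_eps (f : C -> C) (p l : C) : Prop :=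
  forall eps : posreal,
    locally (T := C_UniformSpace) p
      (fun q => (Cmod (f q - f p - l * (q - p)) <= eps * Cmod (q - p))%R).

Lemma is_derive_eps (f : C -> C) (p l : C) :
  is_derive (K := C_AbsRing) (V := AbsRing_NormedModule C_AbsRing) f p l <->
  C_derive_eps f p l.
Proof.
  split.
  - intros [_ H] eps. apply locally_C.
    specialize (H p (fun P HP => HP) eps).
    generalize H. apply filter_imp. intros q Hq.
    rewrite (Cmult_comm l). exact Hq.
  - intros H. split; [apply is_linear_scal_l|].
    intros x Hx. rewrite <- (is_filter_lim_locally_unique
                  (V := AbsRing_NormedModule C_AbsRing) p x Hx).
    intros eps. specialize (H eps). apply locally_C in H.
    generalize H. apply filter_imp. intros q Hq.
    rewrite (Cmult_comm l) in Hq. exact Hq.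
Qed.

(** The two normed modules have the same norm, but their uniform structures, the
    product one and the one of the absolute value, are not convertible. *)
Lemma is_derive_C_NormedModule (f : C -> C) (p l : C) :
  is_derive (K := C_AbsRing) (V := C_NormedModule) f p l <->
  is_derive (K := C_AbsRing) (V := AbsRing_NormedModule C_AbsRing) f p l.
Proof.
  split; intros [_ H]; (split; [apply is_linear_scal_l | exact H]).
Qed.

Lemma Cexp_plus (p q : C) : Cexp (p + q) = Cexp p * Cexp q.
Proof.
  destruct p as [a b], q as [c d]. unfold Cexp, Cmult. simpl.
  rewrite exp_plus, cos_plus, sin_plus. f_equal; ring.
Qed.

Lemma Cexp_0 : Cexp 0 = 1.
Proof.
  unfold Cexp. simpl. rewrite exp_0, cos_0, sin_0.
  apply injective_projections; simpl; ring.
Qed.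

Lemma Cexp_neq_0 (p : C) : Cexp p <> 0.
Proof.
  intros H. apply C1_nz. rewrite <- Cexp_0.
  replace (RtoC 0) with (p + - p) by ring. rewrite Cexp_plus, H. ring.
Qed.

Lemma locally_C_Cmod (p : C) (P : C -> Prop) :
  locally (T := C_UniformSpace) p P <->
  exists d : posreal, forall q, (Cmod (q - p) < d)%R -> P q.
Proof.
  rewrite locally_C. split; intros [d Hd]; exists d; intros q Hq; apply Hd; exact Hq.
Qed.

Lemma filterlim_eps (g : C -> C) (p l : C) :
  filterlim g (locally' (T := C_UniformSpace) p) (locally (T := C_UniformSpace) l) <->
  forall eps : posreal,
    locally (T := C_UniformSpace) p (fun q => q <> p -> (Cmod (g q - l) < eps)%R).
Proof.
  split.
  - intros H eps. apply (H (fun z => (Cmod (z - l) < eps)%R)).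
    apply locally_C_Cmod. now exists eps.
  - intros H P HP. apply locally_C_Cmod in HP. destruct HP as [eps HP].
    unfold filtermap, locally', within.
    generalize (H eps). apply filter_imp. intros q Hq Hqp. apply HP, Hq, Hqp.
Qed.

Lemma Cmod_lower (a b : C) : (Cmod b - Cmod (a - b) <= Cmod a)%R.
Proof.
  pose proof (Cmod_triangle a (-(a - b))) as H. rewrite Cmod_opp in H.
  replace (a + - (a - b)) with b in H by ring. lra.
Qed.

Lemma Cmod_le_Re_Im (z : C) : (Cmod z <= Rabs (Re z) + Rabs (Im z))%R.
Proof.
  replace z with (RtoC (Re z) + Ci * RtoC (Im z)) at 1.
  - eapply Rle_trans; [apply Cmod_triangle|].
    rewrite Cmod_mult, !Cmod_R, Cmod_Ci. lra.
  - destruct z as [a b]. apply injective_projections; simpl; ring.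
Qed.

Lemma Rderive_eps (f : R -> R) (x l : R) (eps : posreal) :
  is_derive f x l ->
  locally x (fun y => (Rabs (f y - f x - l * (y - x)) <= eps * Rabs (y - x))%R).
Proof.
  intros [_ H]. generalize (H x (fun P HP => HP) eps). apply filter_imp.
  intros y Hy. rewrite (Rmult_comm l). exact Hy.
Qed.

(** For [h = a + b i] the real and imaginary parts of [exp h - 1 - h] are
    [(e^a - 1 - a) + e^a (cos b - 1)] and [e^a (sin b - b) + (e^a - 1) b]. *)
Lemma Cexp_derive_0 : C_derive_eps Cexp 0 1.
Proof.
  intros eps.
  (* With [eta] for the three real functions, the two parts are at most
     [3 eta |h|] each. *)
  assert (Heta : (0 < Rmin (eps / 6) 1)%R)
    by (apply Rmin_glb_lt; pose proof (cond_pos eps); lra).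
  set (eta := mkposreal _ Heta).
  assert (He1 : (eta <= 1)%R) by apply Rmin_r.
  assert (He2 : (6 * eta <= eps)%R)
    by (pose proof (Rmin_l (eps / 6) 1); simpl in *; lra).
  pose proof (Rderive_eps exp 0 (exp 0) eta (is_derive_exp 0)) as [d1 H1].
  pose proof (Rderive_eps cos 0 (- sin 0) eta (is_derive_cos 0)) as [d2 H2].
  pose proof (Rderive_eps sin 0 (cos 0) eta (is_derive_sin 0)) as [d3 H3].
  rewrite exp_0 in H1. rewrite sin_0, cos_0 in H2. rewrite sin_0, cos_0 in H3.
  assert (Hd : (0 < Rmin (Rmin d1 (eta / 2)) (Rmin d2 d3))%R).
  { repeat apply Rmin_glb_lt; try apply cond_pos.
    pose proof (cond_pos eta). lra. }
  apply locally_C_Cmod. exists (mkposreal _ Hd). intros [a b] Hh. cbn [pos] in Hh.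
  replace ((a, b) - 0) with (a, b) in Hh |- *
    by (apply injective_projections; simpl; ring).
  assert (Ha : (Rabs a <= Cmod (a, b))%R) 
    by (eapply Rle_trans; [apply Rmax_l | exact (Rmax_Cmod (a, b))]).
  assert (Hb : (Rabs b <= Cmod (a, b))%R) 
    by (eapply Rle_trans; [apply Rmax_r | exact (Rmax_Cmod (a, b))]).
  pose proof (Rmin_l (Rmin d1 (eta / 2)) (Rmin d2 d3)) as Hm1.
  pose proof (Rmin_r (Rmin d1 (eta / 2)) (Rmin d2 d3)) as Hm2.
  pose proof (Rmin_l d1 (eta / 2)). pose proof (Rmin_r d1 (eta / 2)).
  pose proof (Rmin_l d2 d3). pose proof (Rmin_r d2 d3).
  set (h := Cmod (a, b)) in *.
  assert (Hball : forall (x : R) (d : posreal), (Rabs x < d)%R ->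
            ball (0 : R_UniformSpace) d x).
  { intros x d Hx. unfold ball; simpl; unfold AbsRing_ball, abs; simpl.
    unfold minus, plus, opp; simpl. now rewrite Ropp_0, Rplus_0_r. }
  specialize (H1 a (Hball a d1 ltac:(lra))). specialize (H2 b (Hball b d2 ltac:(lra))).
  specialize (H3 b (Hball b d3 ltac:(lra))).
  rewrite Rminus_0_r in H1, H2. rewrite (Rminus_0_r b), (Rminus_0_r (sin b)) in H3.
  replace (cos b - 1 - - 0 * b)%R with (cos b - 1)%R in H2 by ring.
  replace (sin b - 1 * b)%R with (sin b - b)%R in H3 by ring.
  assert (Hexp : (Rabs (exp a - 1) <= eta)%R).
  { replace (exp a - 1)%R with (exp a - 1 - 1 * a + a)%R by ring.
    eapply Rle_trans; [apply Rabs_triang|].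
    pose proof (Rabs_pos a). nra. }
  assert (Hexp2 : (Rabs (exp a) <= 2)%R).
  { replace (exp a) with (exp a - 1 + 1)%R by ring.
    eapply Rle_trans; [apply Rabs_triang|]. rewrite Rabs_R1. lra. }
  rewrite Cexp_0.
  eapply Rle_trans; [apply Cmod_le_Re_Im|]. simpl.
  replace (exp a * cos b + - (1) + - (1 * a - 0 * b))%R
    with (exp a - 1 - 1 * a + exp a * (cos b - 1))%R by ring.
  replace (exp a * sin b + - 0 + - (1 * b + 0 * a))%R
    with (exp a * (sin b - b) + (exp a - 1) * b)%R by ring.
  pose proof (Rabs_triang (exp a - 1 - 1 * a) (exp a * (cos b - 1))) as T1.
  pose proof (Rabs_triang (exp a * (sin b - b)) ((exp a - 1) * b)) as T2.
  rewrite Rabs_mult in T1. rewrite !Rabs_mult in T2.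
  assert (P0 : (eta * Rabs a <= eta * h)%R)
    by (apply Rmult_le_compat_l; [apply Rlt_le, cond_pos | exact Ha]).
  assert (P4 : (eta * Rabs b <= eta * h)%R)
    by (apply Rmult_le_compat_l; [apply Rlt_le, cond_pos | exact Hb]).
  assert (P1 : (Rabs (exp a) * Rabs (cos b - 1) <= 2 * (eta * h))%R)
    by (apply Rmult_le_compat; try apply Rabs_pos; lra).
  assert (P2 : (Rabs (exp a) * Rabs (sin b - b) <= 2 * (eta * h))%R)
    by (apply Rmult_le_compat; try apply Rabs_pos; lra).
  assert (P3 : (Rabs (exp a - 1) * Rabs b <= eta * h)%R)
    by (apply Rmult_le_compat; try apply Rabs_pos; lra).
  assert (P5 : (6 * eta * h <= eps * h)%R)
    by (apply Rmult_le_compat_r; [apply Cmod_ge_0 | exact He2]).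
  lra.
Qed.

Lemma Cexp_derive (p : C) : C_derive_eps Cexp p (Cexp p).
Proof.
  intros eps. pose proof (proj1 (Cmod_gt_0 _) (Cexp_neq_0 p)) as He.
  assert (Heps : (0 < eps / Cmod (Cexp p))%R)
    by (apply Rdiv_lt_0_compat; [apply cond_pos | exact He]).
  pose proof (Cexp_derive_0 (mkposreal _ Heps)) as H.
  apply locally_C_Cmod in H. apply locally_C_Cmod.
  destruct H as [d Hd]. exists d. intros q Hq.
  specialize (Hd (q - p)). simpl in Hd.
  replace (q - p - 0) with (q - p) in Hd by ring.
  specialize (Hd Hq). rewrite Cexp_0 in Hd.
  replace (Cexp q - Cexp p - Cexp p * (q - p))
    with (Cexp p * (Cexp (q - p) - 1 - 1 * (q - p))).
  - rewrite Cmod_mult. apply (Rmult_le_compat_l (Cmod (Cexp p))) in Hd; [|lra].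
    eapply Rle_trans; [exact Hd|]. right. field. lra.
  - replace (Cexp q) with (Cexp p * Cexp (q - p)); [ring|].
    rewrite <- Cexp_plus. f_equal. ring.
Qed.

(** With [D = exp q - exp p], [h = q - p] and [e = exp p <> 0]: near [p], [D] and
    [e h] differ by [o(h)] and [|e h| / 2 <= |D| <= 2 |e h|]. So
    [F - l D = o(D)] and [F - l e h = o(h)] are equivalent, for [F = f q - f p].
    The lower bound also shows that the quotient by [D] is a genuine one. *)
Lemma is_xderive_iff (f : C -> C) (p l : C) :
  is_xderive f p l <-> C_derive_eps f p (l * Cexp p).
Proof.
  unfold is_xderive. rewrite filterlim_eps. unfold coord.
  pose proof (proj1 (Cmod_gt_0 _) (Cexp_neq_0 p)) as He.
  set (e := Cexp p) in *.
  assert (Hnear : forall eta : posreal, locally (T := C_UniformSpace) p (fun q =>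
     (Cmod (Cexp q - e - e * (q - p)) <= eta * Cmod (q - p))%R)) by apply Cexp_derive.
  assert (Hhalf : (0 < Cmod e / 2)%R) by lra.
  pose proof (Hnear (mkposreal _ Hhalf)) as Hh. simpl in Hh.
  pose proof (Cmod_ge_0 l) as Hl.
  split; intros H eps.
  (* The tolerances [H1] for [F / D - l] and [H2] for [D - e h] make each of
     the two error terms at most half of what is allowed, with [|l| + 1] in
     place of [|l|] since [l] may vanish. *)
  - assert (H1 : (0 < eps / (4 * Cmod e))%R) by
      (apply Rdiv_lt_0_compat; [apply cond_pos | lra]).
    assert (H2 : (0 < eps / (2 * (Cmod l + 1)))%R) by
      (apply Rdiv_lt_0_compat; [apply cond_pos | lra]).
    generalize (filter_and _ _ (filter_and _ _ (Hnear (mkposreal _ H2)) Hh)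
                  (H (mkposreal _ H1))).
    apply filter_imp. simpl. intros q [[Ha Hb] Hc].
    destruct (classic (q = p)) as [->|Hqp].
    { replace (f p - f p - l * e * (p - p)) with (RtoC 0) by ring.
      replace (p - p) with (RtoC 0) by ring. rewrite Cmod_0. lra. }
    specialize (Hc Hqp).
    set (h := q - p) in *. set (D := Cexp q - e) in *. set (F := f q - f p) in *.
    assert (Hh0 : (0 < Cmod h)%R).
    { apply Cmod_gt_0. intros H0. apply Hqp. replace q with (h + p) by (unfold h; ring).
      rewrite H0. ring. }
    pose proof (Cmod_lower D (e * h)) as Hlow. rewrite Cmod_mult in Hlow.
    assert (HD : D <> 0).
    { apply Cmod_gt_0. nra. }
    assert (HDu : (Cmod D <= 2 * Cmod e * Cmod h)%R).
    { replace D with (D - e * h + e * h) by ring.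
      eapply Rle_trans; [apply Cmod_triangle|]. rewrite Cmod_mult. nra. }
    replace (F - l * e * h) with ((F / D - l) * D + l * (D - e * h)) by (field; exact HD).
    eapply Rle_trans; [apply Cmod_triangle|]. rewrite !Cmod_mult.
    apply Rle_trans with (eps / (4 * Cmod e) * (2 * Cmod e * Cmod h)
                          + Cmod l * (eps / (2 * (Cmod l + 1)) * Cmod h))%R.
    { apply Rplus_le_compat.
      - apply Rmult_le_compat; try apply Cmod_ge_0; [now apply Rlt_le | exact HDu].
      - now apply Rmult_le_compat_l. }
    replace (eps / (4 * Cmod e) * (2 * Cmod e * Cmod h))%R
      with (eps * Cmod h * / 2)%R by (field; lra).
    replace (Cmod l * (eps / (2 * (Cmod l + 1)) * Cmod h))%R
      with (eps * Cmod h * (Cmod l / (Cmod l + 1)) * /2)%R by (field; lra).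
    assert (Hfrac : (Cmod l / (Cmod l + 1) <= 1)%R).
    { apply Rmult_le_reg_r with (Cmod l + 1)%R; [lra|]. field_simplify; lra. }
    pose proof (Rmult_lt_0_compat _ _ (cond_pos eps) Hh0) as Hpos.
    apply (Rmult_le_compat_l _ _ _ (Rlt_le _ _ Hpos)) in Hfrac. lra.
  - assert (H1 : (0 < eps * Cmod e / 8)%R) by
      (pose proof (cond_pos eps); nra).
    assert (H2 : (0 < eps * Cmod e / (8 * (Cmod l + 1)))%R) by
      (apply Rdiv_lt_0_compat; [pose proof (cond_pos eps); nra | lra]).
    generalize (filter_and _ _ (filter_and _ _ (Hnear (mkposreal _ H2)) Hh)
                  (H (mkposreal _ H1))).
    apply filter_imp. simpl. intros q [[Ha Hb] Hc] Hqp.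
    set (h := q - p) in *. set (D := Cexp q - e) in *. set (F := f q - f p) in *.
    assert (Hh0 : (0 < Cmod h)%R).
    { apply Cmod_gt_0. intros H0. apply Hqp. replace q with (h + p) by (unfold h; ring).
      rewrite H0. ring. }
    pose proof (Cmod_lower D (e * h)) as Hlow. rewrite Cmod_mult in Hlow.
    assert (HDl : (Cmod e * Cmod h / 2 <= Cmod D)%R) by nra.
    assert (HD0 : (0 < Cmod D)%R) by nra.
    assert (HD : D <> 0) by now apply Cmod_gt_0.
    replace (F / D - l) with (((F - l * e * h) - l * (D - e * h)) / D) by (field; exact HD).
    rewrite Cmod_div by exact HD.
    apply Rmult_lt_reg_r with (Cmod D); [exact HD0|].
    unfold Rdiv at 1. rewrite Rmult_assoc, Rinv_l, Rmult_1_r by lra.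
    apply Rle_lt_trans with (eps * Cmod e / 8 * Cmod h
                             + Cmod l * (eps * Cmod e / (8 * (Cmod l + 1)) * Cmod h))%R.
    { eapply Rle_trans; [apply Cmod_triangle|]. rewrite Cmod_opp, Cmod_mult.
      apply Rplus_le_compat; [exact Hc|]. now apply Rmult_le_compat_l. }
    replace (Cmod l * (eps * Cmod e / (8 * (Cmod l + 1)) * Cmod h))%R
      with (eps * Cmod e / 8 * Cmod h * (Cmod l / (Cmod l + 1)))%R by (field; lra).
    assert (Hfrac : (Cmod l / (Cmod l + 1) <= 1)%R).
    { apply Rmult_le_reg_r with (Cmod l + 1)%R; [lra|]. field_simplify; lra. }
    pose proof (Rmult_lt_0_compat _ _ (Rmult_lt_0_compat _ _ (cond_pos eps) He) Hh0)
      as Hpos.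
    apply (Rmult_le_compat_l _ _ _ (Rlt_le _ _ Hpos)) in Hfrac.
    pose proof (Rmult_le_compat_l _ _ _ (Rlt_le _ _ (cond_pos eps)) HDl). lra.
Qed.

Lemma c_solves_at_x_solves (u : C -> C -> C) (p t : C) :
  c_solves_at u p t <-> x_solves C_AbsRing Cdiv Cexp u p t.
Proof.
  assert (Hx : forall f q l, is_xderive f q l <->
    is_derive (K := C_AbsRing) (V := AbsRing_NormedModule C_AbsRing) f q (l * Cexp q)).
  { intros f q l. now rewrite is_xderive_iff, is_derive_eps. }
  split; intros [Hu [ut [w [ux [H1 [H2 [H3 H4]]]]]]]; (split; [exact Hu|]);
    exists ut, w, ux; (split; [|split; [|split; [|exact H4]]]).
  - now apply is_derive_C_NormedModule.
  - apply locally_C. generalize H2. apply filter_imp. intros q. apply Hx.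
  - now apply Hx.
  - now apply is_derive_C_NormedModule.
  - apply locally_C in H2. generalize H2. apply filter_imp. intros q. apply Hx.
  - now apply Hx.
Qed.

Lemma C_neq_opp1 (k : C) : k <> - (1) <-> k + 1 <> 0.
Proof.
  split; intros H H0; apply H.
  - replace k with (k + 1 - 1) by ring. rewrite H0. ring.
  - rewrite H0. ring.
Qed.

Lemma c_transf_comp (a b : C) (q : cpoint) :
  a <> - (1) -> b <> - (1) ->
  c_transf a (c_transf b q) = c_transf ((a + 1) * (b + 1) - 1) q.
Proof.
  rewrite !C_neq_opp1. intros Ha Hb. destruct q as [[x t] v].
  unfold c_transf, cpow, coord, lpow.
  f_equal; [f_equal; ring|].
  replace (- (2) * ((a + 1) * (b + 1) - 1) * x)
    with (- (2) * a * ((b + 1) * x) + - (2) * b * x) by ring.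
  rewrite Cexp_plus. field. repeat split; try assumption.
  replace ((a + 1) * (b + 1) - 1 + 1) with ((a + 1) * (b + 1)) by ring.
  now apply Cmult_neq_0.
Qed.

Lemma c_transf_id (q : cpoint) : c_transf 0 q = q.
Proof.
  destruct q as [[x t] v]. unfold c_transf, cpow, coord, lpow.
  f_equal; [f_equal; ring|].
  replace (- (2) * 0 * x) with (RtoC 0) by ring. rewrite Cexp_0. field.
Qed.

Lemma c_transf_iter (k : C) (N : nat) (q : cpoint) :
  k <> - (1) -> Nat.iter N (c_transf k) q = c_transf ((k + 1) ^ N - 1) q.
Proof.
  intros Hk. induction N as [|N IH].
  - simpl. replace (1 - 1) with (RtoC 0) by ring. symmetry. apply c_transf_id.
  - simpl Nat.iter. rewrite IH, c_transf_comp; [|exact Hk|].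
    + f_equal. simpl. ring.
    + apply C_neq_opp1. replace ((k + 1) ^ N - 1 + 1) with ((k + 1) ^ N) by ring.
      now apply Cpow_nz, C_neq_opp1.
Qed.

Lemma c_transf_maps (k : C) : k <> - (1) -> c_maps_into_itself (c_transf k).
Proof.
  intros Hk. pose proof (proj1 (C_neq_opp1 k) Hk) as Hk0. split.
  - exists (c_transf (/ (k + 1) - 1)).
    assert (Hk1 : / (k + 1) - 1 <> - (1)).
    { apply C_neq_opp1. replace (/ (k + 1) - 1 + 1) with (/ (k + 1)) by ring.
      intros H. apply C1_nz. rewrite <- (Cinv_r (k + 1) Hk0), H. ring. }
    split; intros q; rewrite c_transf_comp by assumption;
      rewrite <- (c_transf_id q) at 2; f_equal; field; exact Hk0.
  - intros D u v HD Hrel p t Hpt. unfold c_transf.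
    assert (Hrel' : forall q s, D (q, s) ->
      v ((k + 1) * q) s
      = / (k + 1) * / (k + 1) * Cexp ((1 + 1 - (1 + 1) * (k + 1)) * q) * u q s).
    { intros q s Hq. pose proof (Hrel q s Hq) as H.
      unfold c_transf, cpow, coord, lpow in H. rewrite H.
      replace ((1 + 1 - (1 + 1) * (k + 1)) * q) with (- (2) * k * q) by ring.
      field. exact Hk0. }
    rewrite !c_solves_at_x_solves.
    apply (x_solves_scale_iff C_AbsRing Cdiv Cinv Cexp C_field_theory
             (fun q => proj2 (is_derive_eps Cexp q _) (Cexp_derive q))
             Cexp_plus Cexp_0 u v (k + 1) (/ (k + 1))).
    + now apply Cinv_l.
    + apply locally_C.
      generalize (locally_slice_fst D _ _ HD Hpt).
      apply filter_imp. intros q Hq. exact (Hrel' q t Hq).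
    + apply locally_C.
      generalize (locally_slice_snd D _ _ HD Hpt).
      apply filter_imp. intros s Hs. exact (Hrel' p s Hs).
Qed.

(** The point with logarithm [1] is moved to the one with logarithm
    [(k + 1)^m]. *)
Lemma c_transf_order (k : C) (m : nat) :
  k <> - (1) -> (forall q, Nat.iter m (c_transf k) q = q) <-> (k + 1) ^ m - 1 = 0.
Proof.
  intros Hk. split.
  - intros H. specialize (H (RtoC 1, RtoC 0, RtoC 0)).
    rewrite c_transf_iter in H by exact Hk.
    apply (f_equal (fun q => fst (fst q))) in H. cbn [fst c_transf] in H.
    unfold lpow in H.
    replace ((k + 1) ^ m - 1) with (((k + 1) ^ m - 1 + 1) * 1 - 1) by ring.
    rewrite H. ring.
  - intros H q. rewrite c_transf_iter, H by exact Hk. apply c_transf_id.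
Qed.

Lemma c_transf_cyclic (k : C) (N : nat) :
  k <> - (1) -> (1 <= N)%nat -> (k + 1) ^ N - 1 = 0 ->
  (forall m, (1 <= m < N)%nat -> (k + 1) ^ m - 1 <> 0) ->
  forms_cyclic_group (c_transf k) N.
Proof.
  intros Hk HN HkN Hm. apply forms_cyclic_group_intro; [exact HN| |].
  - now apply c_transf_order.
  - intros m Hmr. apply not_all_ex_not. intros H. apply (Hm m Hmr).
    now apply c_transf_order.
Qed.

Lemma Cexp_pow (z : C) (n : nat) : Cexp z ^ n = Cexp (INR n * z).
Proof.
  induction n as [|n IH].
  - simpl. replace (0 * z) with (RtoC 0) by ring. symmetry. apply Cexp_0.
  - rewrite S_INR, RtoC_plus. simpl. rewrite IH, <- Cexp_plus. f_equal. ring.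
Qed.

Lemma cos_neq_1 (x : R) : (0 < x < 2 * PI)%R -> cos x <> 1%R.
Proof.
  intros Hx H. replace x with (2 * (x / 2))%R in H by field.
  rewrite cos_2a_sin in H.
  assert (Hs : (0 < sin (x / 2))%R) by (apply sin_gt_0; lra). nra.
Qed.

Lemma primitive_root_exists (N : nat) : (1 <= N)%nat ->
  exists z : C, z ^ N = 1 /\ forall m, (1 <= m < N)%nat -> z ^ m <> 1.
Proof.
  intros HN. assert (HN0 : (0 < INR N)%R) by (apply lt_0_INR; lia).
  exists (Cexp (0%R, (2 * PI / INR N)%R)).
  assert (Hpow : forall m, Cexp (0%R, (2 * PI / INR N)%R) ^ m
            = (cos (INR m * (2 * PI / INR N)), sin (INR m * (2 * PI / INR N)))%R).
  { intros m. rewrite Cexp_pow. unfold Cexp. simpl.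
    replace (INR m * 0 - 0 * (2 * PI / INR N))%R with 0%R by ring.
    replace (INR m * (2 * PI / INR N) + 0 * 0)%R
      with (INR m * (2 * PI / INR N))%R by ring.
    now rewrite exp_0, !Rmult_1_l. }
  split.
  - rewrite Hpow. replace (INR N * (2 * PI / INR N))%R with (2 * PI)%R by (field; lra).
    now rewrite cos_2PI, sin_2PI.
  - intros m Hm H. rewrite Hpow in H. apply (f_equal fst) in H. revert H.
    apply cos_neq_1.
    assert (0 < INR m)%R by (apply lt_0_INR; lia).
    assert (INR m < INR N)%R by (apply lt_INR; lia).
    pose proof PI_RGT_0.
    replace (INR m * (2 * PI / INR N))%R with (2 * PI * (INR m / INR N))%R by (field; lra).
    assert (0 < INR m / INR N)%R by (apply Rdiv_lt_0_compat; lra).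
    assert (INR m / INR N < 1)%R
      by (apply Rmult_lt_reg_r with (INR N); [lra|]; field_simplify; lra).
    split; nra.
Qed.

Lemma c_transf_cyclic_any_order (N : nat) : (1 <= N)%nat ->
  exists k : C, k <> - (1) /\ (k + 1) ^ N - 1 = 0
                /\ forms_cyclic_group (c_transf k) N.
Proof.
  intros HN. destruct (primitive_root_exists N HN) as [z [HzN Hz]].
  exists (z - 1).
  assert (Hz1 : z - 1 + 1 = z) by ring.
  assert (Hk : z - 1 <> - (1)).
  { apply C_neq_opp1. rewrite Hz1. intros H. rewrite H in HzN. apply C1_nz.
    rewrite <- HzN. destruct N as [|N]; [lia|]. simpl. ring. }
  assert (HN0 : (z - 1 + 1) ^ N - 1 = 0) by (rewrite Hz1, HzN; ring).
  split; [exact Hk|]. split; [exact HN0|].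
  apply c_transf_cyclic; try assumption.
  intros m Hm. rewrite Hz1. intros H. apply (Hz m Hm).
  replace (z ^ m) with (z ^ m - 1 + 1) by ring. rewrite H. ring.
Qed.

Lemma Ci_sqr : Ci * Ci = - (1).
Proof. apply injective_projections; simpl; ring. Qed.

Lemma c_transf_Ci (x : logsurf) (t u : C) :
  c_transf (Ci - 1) (x, t, u) = (lpow x Ci, t, - cpow x (2 - 2 * Ci) * u).
Proof.
  unfold c_transf. replace (Ci - 1 + 1) with Ci by ring.
  replace (- (2) * (Ci - 1)) with (2 - 2 * Ci) by ring.
  f_equal. simpl. rewrite Cmult_1_r, Ci_sqr. field.
Qed.

Lemma c_transf_Ci_cyclic : forms_cyclic_group (c_transf (Ci - 1)) 4.
Proof.
  assert (Hci : Ci - 1 + 1 = Ci) by ring.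
  apply c_transf_cyclic; [|lia| |].
  - apply C_neq_opp1. rewrite Hci. intros H. injection H. lra.
  - rewrite Hci. simpl. rewrite Cmult_1_r, Cmult_assoc, Ci_sqr. ring.
  - intros m Hm. rewrite Hci. assert (Hm' : m = 1%nat \/ m = 2%nat \/ m = 3%nat) by lia.
    destruct Hm' as [-> | [-> | ->]]; intros H; apply (f_equal fst) in H;
      simpl in H; lra.
Qed.

Lemma square_roots_of_unity (k : C) :
  (k + 1) ^ 2 - 1 = 0 <-> k = 0 \/ k = - (2).
Proof.
  split.
  - intros H. destruct (classic (k = 0)) as [H0|H0]; [now left | right].
    destruct (classic (k + 2 = 0)) as [H2|H2].
    + replace k with (k + 2 - 2) by ring. rewrite H2. ring.
    + exfalso. apply (Cmult_neq_0 k (k + 2) H0 H2). rewrite <- H. simpl. ring.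
  - intros [-> | ->]; simpl; ring.
Qed.

Lemma c_transf_iter_formula (k : C) (N : nat) (x : logsurf) (t u : C) :
  k <> - (1) ->
  Nat.iter N (c_transf k) (x, t, u)
  = (lpow x ((k + 1) ^ N), t,
     1 / (k + 1) ^ (2 * N) * cpow x (- (2) * (k + 1) ^ N + 2) * u).
Proof.
  intros Hk. rewrite c_transf_iter by exact Hk. unfold c_transf.
  replace ((k + 1) ^ N - 1 + 1) with ((k + 1) ^ N) by ring.
  replace (- (2) * ((k + 1) ^ N - 1)) with (- (2) * (k + 1) ^ N + 2) by ring.
  now rewrite <- Cpow_mult_r, Nat.mul_comm.
Qed.

Lemma c_transf_inversion (x : logsurf) (t u : C) :
  let '(x', t', u') := c_transf (- (2)) (x, t, u) in
  coord x' = 1 / coord x /\ t' = t /\ u' = coord x ^ 4 * u.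
Proof.
  unfold c_transf, cpow, coord, lpow. split; [|split; [reflexivity|]].
  - replace ((- (2) + 1) * x) with (- x) by ring.
    assert (H : Cexp x * Cexp (- x) = 1).
    { rewrite <- Cexp_plus, <- Cexp_0. f_equal. ring. }
    rewrite <- H. field. apply Cexp_neq_0.
  - rewrite Cexp_pow. replace (INR 4 : C) with (- (2) * - (2)).
    + replace (- (2) + 1) with (- (1)) by ring. field.
    + apply injective_projections; simpl; ring.
Qed.

Lemma c_inversion_cyclic : forms_cyclic_group (c_transf (- (2))) 2.
Proof.
  apply c_transf_cyclic; [|lia|simpl; ring|].
  - apply C_neq_opp1. intros H. injection H. lra.
  - intros m Hm. replace m with 1%nat by lia. intros H.
    apply (f_equal fst) in H. simpl in H. lra.
Qed.

End ComplexVariables.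

(** * The theorem *)

Theorem mainTheorem1 :
  (* k complex *)
  (forall k : C, k <> (- (1))%C ->
     c_maps_into_itself (c_transf k)
     /\ (forall (N : nat) (x : logsurf) (t u : C),
           Nat.iter N (c_transf k) (x, t, u)
           = (lpow x ((k + 1) ^ N), t,
              1 / (k + 1) ^ (2 * N)
                * cpow x (- (2) * (k + 1) ^ N + 2) * u)%C)
     /\ (forall N : nat, (1 <= N)%nat -> ((k + 1) ^ N - 1 = 0)%C ->
           (forall q : cpoint, Nat.iter N (c_transf k) q = q)
           /\ (exists d : nat, Nat.divide d N
                               /\ forms_cyclic_group (c_transf k) d)
           /\ ((forall m : nat, (1 <= m < N)%nat -> ((k + 1) ^ m - 1 <> 0)%C) ->
               forms_cyclic_group (c_transf k) N)))
  (* k real *)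
  /\ (forall k : R, k <> (-1)%R ->
     r_maps_into_itself (r_transf k)
     /\ (forall (N : nat) (x : posreal) (t u : R),
           Nat.iter N (r_transf k) (x, t, u)
           = (rpow x ((k + 1) ^ N), t,
              1 / (k + 1) ^ (2 * N)
                * rpow x (- 2 * (k + 1) ^ N + 2) * u)%R)
     /\ (forall N : nat, (1 <= N)%nat -> ((k + 1) ^ N - 1 = 0)%R ->
           (forall q : rpoint, Nat.iter N (r_transf k) q = q)
           /\ (exists d : nat, Nat.divide d N
                               /\ forms_cyclic_group (r_transf k) d)
           /\ ((forall m : nat, (1 <= m < N)%nat -> ((k + 1) ^ m - 1 <> 0)%R) ->
               forms_cyclic_group (r_transf k) N)))
  (* N = 2 *)
  /\ (forall k : C, ((k + 1) ^ 2 - 1 = 0)%C <-> k = 0%C \/ k = (- (2))%C)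
  /\ (forall (x : posreal) (t u : R),
        let '(x', t', u') := r_transf (-2) (x, t, u) in
        pos x' = (1 / x)%R /\ t' = t /\ u' = (x ^ 4 * u)%R)
  /\ forms_cyclic_group (r_transf (-2)) 2
  /\ (forall (x : logsurf) (t u : C),
        let '(x', t', u') := c_transf (- (2)) (x, t, u) in
        coord x' = (1 / coord x)%C /\ t' = t /\ u' = (coord x ^ 4 * u)%C)
  /\ forms_cyclic_group (c_transf (- (2))) 2
  (* real roots *)
  /\ (forall k : R,
        (exists N : nat, (1 <= N)%nat /\ ((k + 1) ^ N - 1 = 0)%R)
        <-> k = 0%R \/ k = (-2)%R)
  (* complex roots *)
  /\ (forall N : nat, (1 <= N)%nat ->
        exists k : C, k <> (- (1))%C /\ ((k + 1) ^ N - 1 = 0)%C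
                      /\ forms_cyclic_group (c_transf k) N)
  /\ (forall (x : logsurf) (t u : C),
        c_transf (Ci - 1) (x, t, u)
        = (lpow x Ci, t, - cpow x (2 - 2 * Ci) * u)%C)
  /\ forms_cyclic_group
       (fun q : cpoint =>
          let '(x, t, u) := q in
          (lpow x Ci, t, - cpow x (2 - 2 * Ci) * u)%C) 4.
Proof.
  repeat match goal with |- _ /\ _ => split end.
  - intros k Hk. split; [now apply c_transf_maps|]. split.
    + intros. now apply c_transf_iter_formula.
    + intros N HN HkN. pose proof (proj2 (c_transf_order k N Hk) HkN) as Hid.
      split; [exact Hid|]. split.
      * now apply (forms_cyclic_group_dividing _ N).
      * now apply c_transf_cyclic.
  - intros k Hk. split; [now apply r_transf_maps|]. split.
    + intros. now apply r_transf_iter_formula.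
    + intros N HN HkN. pose proof (proj2 (r_transf_order k N Hk) HkN) as Hid.
      split; [exact Hid|]. split.
      * now apply (forms_cyclic_group_dividing _ N).
      * now apply r_transf_cyclic.
  - exact square_roots_of_unity.
  - exact r_transf_inversion.
  - exact r_inversion_cyclic.
  - exact c_transf_inversion.
  - exact c_inversion_cyclic.
  - exact real_root_of_unity.
  - exact c_transf_cyclic_any_order.
  - exact c_transf_Ci.
  - replace (fun q : cpoint => _) with (c_transf (Ci - 1)); [exact c_transf_Ci_cyclic|].
    apply functional_extensionality. intros [[x t] u]. apply c_transf_Ci.
Qed.
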